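(* Let $C_1,\dots,C_k$ be concept classes over sets $X_1,\dots,X_k$, and let $q$ be one of the two query types: subset query or equivalence query. Suppose each $C_i$ is learnable by an algorithm $A_i$ using only queries of type $q$, where $A_i$ makes $\#q_i=\#q_i(c_i^* )$ queries to learn $c_i^*\in C_i$. If a single positive example $\vec p\in\prod_{i=1}^k c_i^*$ is given, then the target $\prod_{i=1}^k c_i^*$ in the class $\{\prod_{i=1}^k c_i\mid c_i\in C_i\}$ is learnable using (at most) $\sum_{i=1}^k \#q_i$ queries of type $q$ and (at most) $k\cdot\sum_{i=1}^k\#q_i$ membership queries.
   Context: A concept class over a set $X$ is a set of subsets of $X$ (concepts). For a class $D$ over a set $Y$ with unknown target $c^*\in D$, the query types are: membership query: given $x\in Y$, the oracle says whether $x\in c^*$; equivalence query: given $c\in D$, the oracle returns `true' if $c=c^*$, and otherwise some element of $(c\setminus c^* )\cup(c^*\setminus c)$; subset query: given $c\in D$, the oracle returns `true' if $c\subseteq c^*$, and otherwise some element of $c\setminus c^*$. Counterexamples are chosen arbitrarily (possibly adversarially). A learning algorithm for $D$ is an adaptive query strategy that, for every target $c^*\in D$ and every valid behaviour of the oracle, stops after finitely many queries and outputs $c^*$; complexity is measured only by the number of oracle queries. $\#q_i(c_i^* )$ is the (worst-case over valid oracle behaviours) number of queries made by $A_i$ when the target is $c_i^*$. The product learner receives $\vec p$ as input before making queries, and its queries of type $q$ are concepts in the product class. $\prod c_i=c_1\times\cdots\times c_k$ is the Cartesian product. *)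

(* Defs.v *)
From mathcomp Require Import all_boot all_order all_algebra.
From mathcomp Require Import boolp classical_sets reals constructive_ereal ereal.

Set Implicit Arguments.
Unset Strict Implicit.
Unset Printing Implicit Defensive.

Local Open Scope classical_set_scope.

Inductive query_type := Membership | Equivalence | Subset.

Section QueryLearning.
Variable Y : Type.

Inductive query :=
| Mem of Y
| Equ of set Y
| Sub of set Y.

Inductive answer :=
| Yes
| No
| Counterexample of Y.

Definition type_of_query (u : query) : query_type :=
  match u with Mem _ => Membership | Equ _ => Equivalence | Sub _ => Subset end.

(* Equivalence and subset queries must be concepts of the class [D]. *)
Definition query_in (D : set (set Y)) (u : query) : Prop :=
  match u with Mem _ => True | Equ c | Sub c => D c end.

Definition valid_answer (target : set Y) (u : query) (a : answer) : Prop :=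
  match u, a with
  | Mem x, Yes => target x
  | Mem x, No => ~ target x
  | Equ c, Yes => c = target
  | Equ c, Counterexample y => ((c `\` target) `|` (target `\` c)) y
  | Sub c, Yes => c `<=` target
  | Sub c, Counterexample y => (c `\` target) y
  | _, _ => False
  end.

(* Past queries with their answers, the oldest first. *)
Definition history := seq (query * answer).

Inductive action :=
| Ask of query
| Output of set Y.

(* An arbitrary function: only the number of queries matters, not the
   computational cost of choosing them. *)
Definition strategy := history -> action.

(* An answer may depend on the whole past, so that the oracle can be adaptive
   and can answer a repeated query in different ways. *)
Definition oracle := history -> query -> answer.

Definition valid_oracle (target : set Y) (O : oracle) : Prop :=
  forall (h : history) (u : query), valid_answer target u (O h u).

(* History after [n] steps; it no longer changes once [A] has output. *)
Fixpoint transcript (A : strategy) (O : oracle) (n : nat) : history :=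
  match n with
  | 0 => [::]
  | m.+1 => let h := transcript A O m in
            match A h with
            | Ask u => rcons h (u, O h u)
            | Output _ => h
            end
  end.

(* [A] identifies [target] in the class [D] using only queries whose types
   belong to [T]. *)
Definition learns_target (D : set (set Y)) (T : set query_type) (A : strategy)
    (target : set Y) : Prop :=
  forall O : oracle, valid_oracle target O ->
    (forall (n : nat) (u : query), A (transcript A O n) = Ask u ->
       T (type_of_query u) /\ query_in D u) /\
    (exists n : nat, A (transcript A O n) = Output target).

Definition learns (D : set (set Y)) (T : set query_type) (A : strategy) : Prop :=
  forall target : set Y, D target -> learns_target D T A target.

(* The worst-case number of queries of type [t] over all valid oracles: the
   supremum over all prefixes of all runs, [+oo] if there is no finite bound
   (each run may be finite and yet their lengths unbounded). *)
Definition num_queries (R : realType) (t : query_type) (A : strategy)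
    (target : set Y) : \bar R :=
  ereal_sup [set r | exists (O : oracle) (n : nat), valid_oracle target O /\
    r = ((count (fun e : query * answer => `[< type_of_query e.1 = t >])
            (transcript A O n))%:R%R)%:E].

End QueryLearning.

Definition prod_concept (k : nat) (X : 'I_k -> Type)
    (c : forall i, set (X i)) : set (forall i, X i) :=
  [set x | forall i, c i (x i)].

Definition prod_class (k : nat) (X : 'I_k -> Type)
    (C : forall i, set (set (X i))) : set (set (forall i, X i)) :=
  [set D | exists c : forall i, set (X i),
             (forall i, C i (c i)) /\ D = prod_concept c].

(* Main.v *)
Require Import Defs.
From mathcomp Require Import all_boot all_order all_algebra.
From mathcomp Require Import boolp classical_sets reals constructive_ereal ereal.

Local Open Scope classical_set_scope.
Local Open Scope ereal_scope.

(** The product learner simulates all the [A i] in parallel and asks for the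
    product of their current hypotheses. On the answer "yes" every simulated
    query is answered "yes". On a counterexample [x], membership of [p] with
    its [i]-th coordinate replaced by [x i] decides [x i \in c i], so at most
    [k] membership queries find a coordinate at which [x i] is a counterexample
    for the hypothesis of [A i]. Hence each product query, with the at most [k]
    membership queries following it, is paid for by a query of some [A i].

    "Yes" for the product is informative about the factors only when the product
    of the hypotheses is nonempty. So hypotheses whose answer is known for free
    are never asked: the empty set is a subset of the target, and an equivalence
    query whose concept misses [p i] has the counterexample [p i]. *)

(** * Runs against valid answers, and oracles that reproduce them *)

Section Runs.
Set Implicit Arguments.
Unset Strict Implicit.
Local Open Scope nat_scope.
Variables (Y : Type) (A : strategy Y) (t : set Y).

(** The product learner simulates each factor without an oracle for it, so validity is recorded
    answer by answer; [run_oracle] supplies an oracle afterwards. *)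
Inductive run : history Y -> Prop :=
| run_nil : run [::]
| run_rcons h u a : run h -> A h = Ask u -> valid_answer t u a ->
    run (rcons h (u, a)).

Lemma run_rconsP h u a : run (rcons h (u, a)) ->
  [/\ run h, A h = Ask u & valid_answer t u a].
Proof.
move e : (rcons h (u, a)) => h' r; case: r e => [|h1 u1 a1 r1 A1 v1].
  by case: h.
by move=> /rcons_inj[-> -> ->].
Qed.

Lemma run_cat h s : run (h ++ s) -> run h.
Proof.
elim/last_ind: s => [|s [u a] IH]; first by rewrite cats0.
by rewrite -rcons_cat => /run_rconsP[/IH].
Qed.

Lemma run_cons h u a s : run (h ++ (u, a) :: s) ->
  A h = Ask u /\ valid_answer t u a.
Proof. by rewrite -cat_rcons => /run_cat/run_rconsP[]. Qed.

Lemma valid_answer_exists u : exists a, valid_answer t u a.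
Proof.
case: u => [x|c|c].
- by have [?|?] := pselect (t x); [exists (Yes Y)|exists (No Y)].
- have [?|ne] := pselect (c = t); first by exists (Yes Y).
  suff [y Hy] : exists y, ((c `\` t) `|` (t `\` c)) y.
    by exists (Counterexample y).
  apply: contrapT => nex; apply: ne; apply/seteqP; split=> y Hy;
    apply: contrapT => H; apply: nex; exists y; by [left|right].
- have [?|/existsNP[y /not_implyP Hy]] := pselect (c `<=` t).
    by exists (Yes Y).
  by exists (Counterexample y).
Qed.

Lemma chain_cat (hs : nat -> history Y) :
  (forall n, exists s, hs n.+1 = hs n ++ s) ->
  forall n m, n <= m -> exists s, hs m = hs n ++ s.
Proof.
move=> ch n m /subnK <-; elim: (m - n) => [|d [s IH]].
  by exists [::]; rewrite cats0.
by have [s' e] := ch (d + n); exists (s ++ s'); rewrite addSn e IH catA.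
Qed.

(** An oracle sees the whole past, so it can replay the answer recorded in the chain after each
    prefix; the histories extend one another, so that answer is unique. Off the chain any valid
    answer is chosen. *)
Lemma chain_oracle (hs : nat -> history Y) :
    (forall n, run (hs n)) -> (forall n, exists s, hs n.+1 = hs n ++ s) ->
  exists O, valid_oracle t O /\
    forall m n, m <= size (hs n) -> transcript A O m = take m (hs n).
Proof.
move=> rh /chain_cat ch.
have uniq_ans n n' h u a a' s s' : n <= n' -> hs n = h ++ (u, a) :: s ->
    hs n' = h ++ (u, a') :: s' -> a = a'.
  move=> /ch[r ->] -> /(congr1 (drop (size h))).
  by rewrite -catA !drop_size_cat // => -[].
have /boolp.choice[f Hf] : forall hu : history Y * query Y, exists a0,
    valid_answer t hu.2 a0 /\
    forall n a s, hs n = hu.1 ++ (hu.2, a) :: s -> a0 = a.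
  move=> [h u] /=.
  have [[n [a [s e]]]|nex] :=
      pselect (exists n a s, hs n = h ++ (u, a) :: s).
    exists a; split; first by have := rh n; rewrite e => /run_cons[].
    move=> n' a' s' e'; case: (leqP n n') => [|/ltnW] le.
      exact: uniq_ans le e e'.
    by rewrite (uniq_ans _ _ _ _ _ _ _ _ le e' e).
  have [a va] := valid_answer_exists u; exists a; split=> // n a' s' e.
  by case: nex; exists n, a', s'.
exists (fun h u => f (h, u)); split=> [h u|]; first by have [] := Hf (h, u).
elim=> [|m IH] n lt; first by rewrite take0.
rewrite /= (IH n (ltnW lt)).
case E: (drop m (hs n)) => [|[u a] s].
  by move: (congr1 size E) lt; rewrite size_drop /= => /eqP;
    rewrite subn_eq0 leqNgt => /negbTE ->.
have e : hs n = take m (hs n) ++ (u, a) :: s by rewrite -E cat_take_drop.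
have [-> _] : A (take m (hs n)) = Ask u /\ valid_answer t u a.
  by apply: (@run_cons _ _ _ s); rewrite -e.
have [_ /(_ n a s e) ->] := Hf (take m (hs n), u).
have sz : size (take m (hs n)) = m by apply: size_takel; exact: ltnW.
rewrite [in RHS]e take_cat sz ltnNge leqnSn /= subSnn /=.
by rewrite take0 cats1.
Qed.

Lemma run_oracle h : run h ->
  exists O, valid_oracle t O /\
    forall m, m <= size h -> transcript A O m = take m h.
Proof.
move=> rh; have [//||O [vO HO]] := @chain_oracle (fun=> h).
  by move=> _; exists [::]; rewrite cats0.
by exists O; split=> // m; apply: (HO m 0).
Qed.

Lemma run_take_ask h m : run h -> m < size h ->
  exists u, A (take m h) = Ask u.
Proof.
move=> rh lt; case E: (drop m h) => [|[u a] s].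
  by move: lt; rewrite -subn_gt0 -size_drop E.
exists u; suff [] : A (take m h) = Ask u /\ valid_answer t u a by [].
by apply: (@run_cons _ _ _ s); rewrite -E cat_take_drop.
Qed.

Lemma transcript_stop O n m d : A (transcript A O n) = Output d -> n <= m ->
  transcript A O m = transcript A O n.
Proof.
by move=> e /subnK <-; elim: (m - n) => //= r ->; rewrite e.
Qed.

Variables (D : set (set Y)) (T : set query_type).
Hypothesis lA : learns_target D T A t.

Lemma run_ask h u : run h -> A h = Ask u -> T (type_of_query u) /\ query_in D u.
Proof.
move=> /run_oracle[O [vO HO]] e; have [H _] := lA vO.
by apply: (H (size h)); rewrite HO // take_size.
Qed.

(** Some oracle reproduces [h], and against it the target is output at some time. A transcript is
    frozen from its first output on, so the output at [h] is the same. *)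
Lemma run_output h d : run h -> A h = Output d -> d = t.
Proof.
move=> rh e; have [O [vO HO]] := run_oracle rh.
have [_ [n en]] := lA vO.
have eh : transcript A O (size h) = h by rewrite HO // take_size.
(* Strictly inside [h] the algorithm still asks, so the correct output cannot come that early. *)
have [lt|le] := ltnP n (size h).
  by have [u] := run_take_ask rh lt; rewrite -HO 1?ltnW // en.
move: en; rewrite (@transcript_stop _ (size h) n d) // ?eh //.
by rewrite e => -[].
Qed.

(** Termination is known only oracle by oracle, so one oracle is made to drive the whole chain; the
    time at which [A] stops against it bounds every size. *)
Lemma chain_bounded (hs : nat -> history Y) :
    (forall n, run (hs n)) -> (forall n, exists s, hs n.+1 = hs n ++ s) ->
  exists N, forall n, size (hs n) <= N.
Proof.
move=> rh ch; have [O [vO HO]] := chain_oracle rh ch.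
have [_ [n0 e]] := lA vO; exists n0 => n; rewrite leqNgt; apply/negP => lt.
by have [u] := run_take_ask (rh n) lt; rewrite -HO 1?ltnW // e.
Qed.

(** Every query of [A] has type [q], so counting that type counts the whole history. *)
Lemma size_run_le_num_queries (R : realType) (q : query_type) h :
  T = [set q] -> run h -> ((size h)%:R%R%:E <= num_queries R q A t)%E.
Proof.
move=> eT rh; have [O [vO HO]] := run_oracle rh.
apply: ereal_sup_ubound; exists O, (size h); split=> //.
rewrite HO // take_size; congr (_%:R%R%:E); symmetry.
elim: {vO HO} h / rh => // h u a rh IH e va.
rewrite -cats1 count_cat size_cat IH /=.
by have [] := run_ask rh e; rewrite eT /= => -> _; rewrite asboolT.
Qed.

End Runs.

(** * Answers known for free from emptiness or the positive example *)

Section FreeAnswers.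
Set Implicit Arguments.
Unset Strict Implicit.
Local Open Scope nat_scope.
Variables (Y : Type) (A : strategy Y) (p : Y).

Definition free_answer (u : query Y) : option (answer Y) :=
  match u with
  | Defs.Mem _ => None
  | Equ c => if `[< c p >] then None else Some (Counterexample p)
  | Defs.Sub c => if `[< c = set0 >] then Some (Yes Y) else None
  end.

Definition free_step (h : history Y) : history Y :=
  if A h is Ask u then
    if free_answer u is Some a then rcons h (u, a) else h
  else h.

Definition normal (h : history Y) : Prop := free_step h = h.

(** [xget] picks some number of free steps that reaches a [normal] history, with default 0 if there
    is none; [normalize_normal] shows that one exists on runs. *)
Definition normalize (h : history Y) : history Y :=
  iter (xget 0 [set n | normal (iter n free_step h)]) free_step h.

Lemma free_step_cat h : exists s, free_step h = h ++ s.
Proof.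
rewrite /free_step; case: (A h) => [u|d]; last by exists [::]; rewrite cats0.
case: (free_answer u) => [a|]; last by exists [::]; rewrite cats0.
by exists [:: (u, a)]; rewrite cats1.
Qed.

Lemma normalize_cat h : exists s, normalize h = h ++ s.
Proof.
rewrite /normalize; elim: (xget _ _) => [|n [s IH]] /=.
  by exists [::]; rewrite cats0.
by have [s' ->] := free_step_cat (iter n free_step h);
  exists (s ++ s'); rewrite IH catA.
Qed.

Lemma normalP h u : normal h -> A h = Ask u -> free_answer u = None.
Proof.
rewrite /normal /free_step => + e; rewrite e; case: (free_answer u) => // a.
by move=> /(congr1 size); rewrite size_rcons => /eqP;
  rewrite -[X in _ == X]addn0 -addn1 eqn_add2l.
Qed.

Variable t : set Y.
Hypothesis tp : t p.

Lemma valid_free_answer u a : free_answer u = Some a -> valid_answer t u a.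
Proof.
case: u => [x|c|c] //=; case: asboolP => // H [<-] /=.
  by right.
by rewrite H.
Qed.

Lemma run_free_step h : run A t h -> run A t (free_step h).
Proof.
rewrite /free_step => rh; case E: (A h) => [u|//].
by case F: (free_answer u) => [a|//]; apply: run_rcons => //;
  apply: valid_free_answer.
Qed.

Lemma run_normalize h : run A t h -> run A t (normalize h).
Proof.
by rewrite /normalize => rh; elim: (xget _ _) => //= n; apply: run_free_step.
Qed.

(** Free answers are valid, so iterating [free_step] gives a chain of runs; by [chain_bounded] it
    cannot grow at every step. *)
Lemma normalize_normal (D : set (set Y)) (T : set query_type) h :
  learns_target D T A t -> run A t h -> normal (normalize h).
Proof.
move=> lA rh.
suff [n Hn] : exists n, normal (iter n free_step h).
  exact: (@xgetPex _ 0 [set n | normal (iter n free_step h)] (ex_intro _ n Hn)).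
have [|n|N HN] := @chain_bounded _ _ _ _ _ lA (fun n => iter n free_step h).
- by elim=> //= n; apply: run_free_step.
- exact: free_step_cat.
apply: contrapT => /forallNP nn.
suff /(_ N.+1) H : forall n, n <= size (iter n free_step h).
  by have := leq_trans H (HN _); rewrite ltnn.
elim=> //= n IH; apply: leq_ltn_trans IH _.
have [[|e s] es] := free_step_cat (iter n free_step h).
  by case: (nn n); rewrite /normal es cats0.
by rewrite es size_cat /= addnS ltnS leq_addr.
Qed.

End FreeAnswers.

(** * Counting lemmas and inclusions between products *)

Lemma count_rcons {T : Type} (a : pred T) s x :
  count a (rcons s x) = (count a s + a x)%N.
Proof. by rewrite -cats1 count_cat /= addn0. Qed.

Lemma ltn_sum {I : finType} (f g : I -> nat) (i0 : I) :
  (forall i, f i <= g i)%N -> (f i0 < g i0)%N ->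
  (\sum_i f i < \sum_i g i)%N.
Proof.
move=> le lt; rewrite (bigD1 i0) //= [ltnRHS](bigD1 i0) //=.
by rewrite -addSn leq_add // leq_sum.
Qed.

Section ProductConcept.
Set Implicit Arguments.
Unset Strict Implicit.
Variables (k : nat) (X : 'I_k -> Type).

Lemma prod_concept_dfwith (c : forall i, set (X i)) y i (x : X i) :
  prod_concept c y -> prod_concept c (dfwith y x) <-> c i x.
Proof.
move=> cy; split=> [/(_ i)|cx j]; first by rewrite dfwith_in.
by case: dfwithP.
Qed.

(** The point [y] lets one coordinate vary alone inside the first product. *)
Lemma prod_concept_subset (a b : forall i, set (X i)) y :
  prod_concept a y -> prod_concept a `<=` prod_concept b ->
  forall i, a i `<=` b i.
Proof.
move=> ay ab i x /(prod_concept_dfwith x ay)/ab by_; have := by_ i.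
by rewrite dfwith_in.
Qed.

End ProductConcept.

(** * The product learner as a state machine *)

Section ProductLearner.
Set Implicit Arguments.
Unset Strict Implicit.
Local Open Scope nat_scope.
Variables (k : nat) (X : 'I_k -> Type) (C : forall i, set (set (X i))).
Variables (q : query_type) (A : forall i, strategy (X i)).
Variable (p : forall i, X i).
Arguments C : clear implicits.
Arguments A : clear implicits.

(** A stopped algorithm keeps contributing its output. [set0] after a membership query is a default
    value. *)
Definition hypothesis i (h : history (X i)) : set (X i) :=
  match A i h with
  | Ask (Defs.Mem _) => set0
  | Ask (Equ c) | Ask (Defs.Sub c) | Output c => c
  end.

Definition is_output Y (b : action Y) : bool :=
  if b is Output _ then true else false.

Definition states := forall i, history (X i).

Definition advance (f : forall i, option (answer (X i))) (s : states) :
    states :=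
  fun i => match A i (s i), f i with
           | Ask u, Some a => normalize (A i) (p i) (rcons (s i) (u, a))
           | _, _ => s i
           end.
Arguments advance : clear implicits.

Definition hypotheses (s : states) : forall i, set (X i) :=
  fun i => hypothesis (s i).
Arguments hypotheses : clear implicits.

Definition product_query (s : states) : query (forall i, X i) :=
  if q is Subset then Defs.Sub (prod_concept (hypotheses s))
  else Equ (prod_concept (hypotheses s)).

(* [Some (x, l)]: the last product query got the counterexample [x], and the
   coordinates in [l] remain to be tested. *)
Definition phase := option ((forall i, X i) * seq 'I_k)%type.

(** [Output set0] is a default value: [pending_ok] keeps a misclassified coordinate in the list, so
    the list never runs out. *)
Definition product_action (st : states * phase) : action (forall i, X i) :=
  match st.2 with
  | None => if [forall i, is_output (A i (st.1 i))]
            then Output (prod_concept (hypotheses st.1))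
            else Ask (product_query st.1)
  | Some (x, i :: _) => Ask (Defs.Mem (dfwith p (x i)))
  | Some (x, [::]) => Output set0
  end.

Definition is_yes Y (a : answer Y) : bool := if a is Yes then true else false.

(** [b] stands for the truth about [x i]: the membership answer in the learner, [c i (x i)] in its
    analysis. *)
Definition misclassifies (s : states) (x : forall i, X i) (b : Prop)
    (i : 'I_k) : Prop :=
  ~ (hypotheses s i (x i) <-> b).

Definition counterexample_at (x : forall i, X i) (i j : 'I_k) :
    option (answer (X j)) :=
  if j == i then Some (Counterexample (x j)) else None.

Definition update (st : states * phase)
    (e : query (forall i, X i) * answer (forall i, X i)) : states * phase :=
  match st.2, e.2 with
  | None, Counterexample x => (st.1, Some (x, enum 'I_k))
  | None, _ => (advance (fun i => Some (Yes (X i))) st.1, None)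
  | Some (x, i :: l), a =>
      if `[< misclassifies st.1 x (is_yes a) i >]
      then (advance (counterexample_at x i) st.1, None)
      else (st.1, Some (x, l))
  | Some (x, [::]), _ => st
  end.

Definition product_state (h : history (forall i, X i)) : states * phase :=
  foldl update (fun i => normalize (A i) (p i) [::], None) h.

Definition product_strategy : strategy (forall i, X i) :=
  fun h => product_action (product_state h).

Lemma product_state_rcons h e :
  product_state (rcons h e) = update (product_state h) e.
Proof. by rewrite /product_state foldl_rcons. Qed.

Lemma advance_cat f s i : exists r, advance f s i = s i ++ r.
Proof.
rewrite /advance; case: (A i _) => [u|d]; last by exists [::]; rewrite cats0.
case: (f i) => [a|]; last by exists [::]; rewrite cats0.
have [r ->] := normalize_cat (A i) (p i) (rcons (s i) (u, a)).
by exists ((u, a) :: r); rewrite cat_rcons.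
Qed.

Lemma update_cat st e i : exists r, (update st e).1 i = st.1 i ++ r.
Proof.
case: st => s [[x [|j l]]|]; rewrite /update /=.
- by exists [::]; rewrite cats0.
- case: asboolP => _; last by exists [::]; rewrite cats0.
  exact: advance_cat.
- by case: e.2 => [||x]; try exact: advance_cat; exists [::]; rewrite cats0.
Qed.

(** * Validity of the simulated answers *)

Hypothesis hq : q = Subset \/ q = Equivalence.
Hypothesis hA : forall i, learns (C i) [set q] (A i).
Variable c : forall i, set (X i).
Arguments c : clear implicits.
Arguments hA : clear implicits.
Hypothesis Cc : forall i, C i (c i).
Hypothesis cp : prod_concept c p.

Let lA i : learns_target (C i) [set q] (A i) (c i) := hA i (c i) (Cc i).

Arguments lA : clear implicits.

Definition consistent (s : states) : Prop :=
  forall i, run (A i) (c i) (s i) /\ normal (A i) (p i) (s i).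

(** The potential that pays for the product queries; freely answered queries count in it too. *)
Definition total (s : states) : nat := \sum_i size (s i).

Lemma hypothesis_output s i : consistent s -> is_output (A i (s i)) ->
  hypotheses s i = c i.
Proof.
move=> /(_ i)[r _]; rewrite /hypotheses /hypothesis.
by case E: (A i _) => [//|d] _; have := run_output (lA i) r E.
Qed.

Lemma hypotheses_in s i : consistent s -> C i (hypotheses s i).
Proof.
move=> cs; have [r _] := cs i.
case E: (A i (s i)) => [u|d]; last by rewrite hypothesis_output // E.
have [/= Tu] := run_ask (lA i) r E; rewrite /hypotheses /hypothesis E.
by case: u Tu {E} => //= _ qM; case: hq; rewrite -qM.
Qed.

Lemma consistent_advance f s : consistent s ->
  (forall i u a, A i (s i) = Ask u -> f i = Some a -> valid_answer (c i) u a) ->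
  consistent (advance f s).
Proof.
move=> cs vf i; rewrite /advance; have := cs i; have := vf i.
case E: (A i _) => [u|//]; case: (f i) => [a|//] va [rs _].
have rs' : run (A i) (c i) (rcons (s i) (u, a)).
  by apply: run_rcons => //; exact: va.
by split; [apply: run_normalize | apply: normalize_normal (lA i) _].
Qed.

Lemma total_advance f s i u a : A i (s i) = Ask u -> f i = Some a ->
  total s < total (advance f s).
Proof.
move=> E F; apply: (@ltn_sum _ _ _ i) => [j|].
  by have [r ->] := advance_cat f s j; rewrite size_cat leq_addr.
rewrite /advance E F.
have [r ->] := normalize_cat (A i) (p i) (rcons (s i) (u, a)).
by rewrite size_cat size_rcons leq_addr.
Qed.

Lemma consistent_init : consistent (fun i => normalize (A i) (p i) [::]).
Proof.
have r0 i := run_nil (A i) (c i).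
by move=> i; split; [apply: run_normalize | apply: normalize_normal (lA i) _].
Qed.

(** Normality excludes the free hypotheses, so the product of the hypotheses is nonempty for subset
    queries and contains [p] for equivalence queries. Inclusion or equality of products then passes
    to the factors. *)
Lemma valid_product_yes s i u : consistent s ->
  valid_answer (prod_concept c) (product_query s) (Yes _) ->
  A i (s i) = Ask u -> valid_answer (c i) u (Yes _).
Proof.
move=> cs; rewrite /product_query => vy E; have [r n] := cs i.
have [/= Tu _] := run_ask (lA i) r E.
have hE j v : A j (s j) = Ask v -> type_of_query v = q /\
    free_answer (p j) v = None.
  move=> Ej; have [rj nj] := cs j; split; last exact: normalP nj Ej.
  by have [] := run_ask (lA j) rj Ej.
have hyp_i : hypotheses s i =
    match u with Defs.Mem _ => set0 | Equ d | Defs.Sub d => d end.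
  by rewrite /hypotheses /hypothesis E.
case: hq => eq_q; rewrite eq_q in vy hE Tu.
- have [y Hy] : exists y, prod_concept (hypotheses s) y.
    suff ne j : exists z, hypotheses s j z.
      by exists (fun j => sval (cid (ne j))) => j; exact: svalP.
    (* A stopped algorithm has found [c j], which contains [p j]. *)
    case Ej: (A j (s j)) => [v|d]; last first.
      by exists (p j); rewrite hypothesis_output ?Ej //; exact: cp.
    have [] := hE _ _ Ej; rewrite /hypotheses /hypothesis Ej.
    case: v {Ej} => //= d _; case: asboolP => // /eqP/set0P[z dz] _.
    by exists z.
  have := prod_concept_subset Hy vy (i := i).
  by rewrite hyp_i; case: u Tu {E hyp_i}.
- have Hp : prod_concept (hypotheses s) p.
    move=> j; case Ej: (A j (s j)) => [v|d]; last first.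
      by rewrite hypothesis_output ?Ej //; exact: cp.
    have [] := hE _ _ Ej; rewrite /hypotheses /hypothesis Ej.
    by case: v {Ej} => //= d _; case: asboolP.
  move: Tu E hyp_i; case: u => //= d _ E <-; apply/seteqP; split.
    by apply: (prod_concept_subset Hp); rewrite vy.
  by apply: (prod_concept_subset cp); rewrite vy.
Qed.

(** For subset queries [x] lies in every hypothesis, so at a misclassified coordinate [x i] lies
    outside [c i], as a subset counterexample must. *)
Definition pending_ok (s : states) (x : forall i, X i) (l : seq 'I_k) : Prop :=
  (q = Subset -> prod_concept (hypotheses s) x) /\
  exists2 i, i \in l & misclassifies s x (c i (x i)) i.

(** If no coordinate were misclassified, [x] would lie in both products or in neither. *)
Lemma valid_product_counterexample s x :
  valid_answer (prod_concept c) (product_query s) (Counterexample x) ->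
  pending_ok s x (enum 'I_k).
Proof.
move=> v.
have [hx ne] : (q = Subset -> prod_concept (hypotheses s) x) /\
    ~ (prod_concept (hypotheses s) x <-> prod_concept c x).
  by move: v; rewrite /product_query; case: hq => -> /=; [case|move=> [[]|[]]];
    move=> ? ?; split=> //; tauto.
split=> //; apply: contrapT => /forall2NP H; apply: ne.
have {}H i : hypotheses s i (x i) <-> c i (x i).
  by apply: contrapT => m; case: (H i); rewrite ?mem_enum.
by split=> y i; apply/H.
Qed.

Lemma valid_misclassified s x i u : consistent s ->
  (q = Subset -> prod_concept (hypotheses s) x) ->
  misclassifies s x (c i (x i)) i -> A i (s i) = Ask u ->
  valid_answer (c i) u (Counterexample (x i)).
Proof.
move=> cs /[swap]; rewrite /misclassifies => m hx E; have [r _] := cs i.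
have [/= Tu _] := run_ask (lA i) r E; have {}hx H := hx H i.
move: Tu m hx; rewrite /hypotheses /hypothesis E.
case: u {E} => //= [y|d|d] Tu; rewrite -Tu.
- by case: hq; rewrite -Tu.
- by move=> m _; have [|] := pselect (d (x i)); have [|] := pselect (c i (x i));
    rewrite /=; [move=> *; case: m | left | right | move=> *; case: m].
- by move=> m /(_ erefl) dx; split=> // cx; apply: m.
Qed.

Lemma misclassified_ask s x i : consistent s ->
  misclassifies s x (c i (x i)) i -> exists u, A i (s i) = Ask u.
Proof.
move=> cs; case E: (A i (s i)) => [u|d]; first by exists u.
by case; rewrite hypothesis_output ?E.
Qed.

Lemma valid_mem (x : forall i, X i) i a :
  valid_answer (prod_concept c) (Defs.Mem (dfwith p (x i))) a ->
  is_yes a <-> c i (x i).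
Proof.
by case: a => //= [/(prod_concept_dfwith _ cp)|/(prod_concept_dfwith _ cp)].
Qed.

(** * Accounting for the queries *)

Definition count_type (t : query_type) (h : history (forall i, X i)) : nat :=
  count (fun e => `[< type_of_query e.1 = t >]) h.

(** While tests are pending, the product query has been made but the step of some [A i] that pays
    for it is still to come: hence [.+1]. The term [size l] reserves the remaining tests. The bound
    on [size h] serves termination. *)
Definition phase_ok (s : states) (ph : phase) (h : history (forall i, X i)) :
    Prop :=
  if ph is Some (x, l) then
    [/\ pending_ok s x l,
        count_type q h <= (total s).+1,
        count_type Membership h + size l <= k * (total s).+1
      & size h + size l <= k.+1 * (total s).+1]
  else
    [/\ count_type q h <= total s,
        count_type Membership h <= k * total s
      & size h <= k.+1 * total s].

Lemma type_product_query s : type_of_query (product_query s) = q.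
Proof. by rewrite /product_query; case: hq => ->. Qed.

Lemma neq_Membership : q <> Membership.
Proof. by case: hq => ->. Qed.

Lemma advance_counterexample s x i : consistent s ->
    (q = Subset -> prod_concept (hypotheses s) x) ->
    misclassifies s x (c i (x i)) i ->
  consistent (advance (counterexample_at x i) s) /\
  total s < total (advance (counterexample_at x i) s).
Proof.
move=> cs hx m; split.
  apply: consistent_advance => // j u a E; rewrite /counterexample_at.
  case: eqP => // ji [<-]; apply: valid_misclassified E => //.
  by rewrite ji.
have [u E] := misclassified_ask cs m.
by apply: total_advance E _; rewrite /counterexample_at eqxx.
Qed.

Lemma update_ok s ph h u a :
    consistent s -> phase_ok s ph h -> product_action (s, ph) = Ask u ->
    valid_answer (prod_concept c) u a ->
  consistent (update (s, ph) (u, a)).1 /\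
  phase_ok (update (s, ph) (u, a)).1 (update (s, ph) (u, a)).2 (rcons h (u, a)).
Proof.
move=> cs; rewrite /product_action /=.
case: ph => [[x [|i l]]|] //=.
- case=> -[hx [j jl mj]] cq cm sz [<-] va.
  have yi := valid_mem va; rewrite /update /=.
  have tq : count_type q (rcons h (Defs.Mem (dfwith p (x i)), a)) =
      count_type q h.
    rewrite /count_type count_rcons /= asboolF ?addn0 //.
    by move=> e; apply: neq_Membership.
  have tm : count_type Membership (rcons h (Defs.Mem (dfwith p (x i)), a)) =
      (count_type Membership h).+1.
    by rewrite /count_type count_rcons /= asboolT // addn1.
  (* The test just made moves one unit from the reserve to the count. *)
  move: cm sz; rewrite /= -!addSnnS => cm sz.
  case: asboolP => mi.
    have {}mi : misclassifies s x (c i (x i)) i.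
      by rewrite /misclassifies -yi.
    have [cs' lt] := advance_counterexample cs hx mi.
    split=> //; rewrite /= tq tm size_rcons; split.
    + exact: leq_trans cq _.
    + apply: leq_trans (leq_addr _ _) (leq_trans cm _).
      by rewrite leq_mul2l lt orbT.
    + apply: leq_trans (leq_addr _ _) (leq_trans sz _).
      by rewrite leq_mul2l lt orbT.
  split=> //; rewrite /= tq tm size_rcons; split=> //; split=> //.
  (* Coordinate [i] has proved correct, so the misclassified [j] is still in [l]. *)
  exists j => //; move: jl; rewrite inE => /orP[/eqP ji|//].
  by case: mi; move: mj; rewrite /misclassifies ji yi.
- case: forallP => //= /existsNP[i /negP ni] [cq cm sz] [<-] va.
  have tq : count_type q (rcons h (product_query s, a)) = (count_type q h).+1.
    by rewrite /count_type count_rcons /= type_product_query asboolT // addn1.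
  have tm : count_type Membership (rcons h (product_query s, a)) =
      count_type Membership h.
    rewrite /count_type count_rcons /= type_product_query asboolF ?addn0 //.
    exact: neq_Membership.
  case: a va tq tm => [va|va|x va] tq tm.
  (* Some [A i] has not stopped, and its advance makes [total] grow strictly. *)
  + have [w Eu] : exists w, A i (s i) = Ask w.
      by case: (A i (s i)) ni => // w; exists w.
    have lt := total_advance (f := fun j => Some (Yes (X j))) Eu erefl.
    split.
      apply: consistent_advance => // j v b E [<-].
      exact: valid_product_yes va E.
    rewrite /update /= tq tm size_rcons; split.
    * exact: leq_ltn_trans cq lt.
    * by apply: leq_trans cm _; rewrite leq_mul2l ltnW ?orbT.
    * apply: leq_ltn_trans sz _; rewrite ltn_mul2l lt //.
  + by move: va; rewrite /product_query; case: hq => ->.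
  + split=> //; rewrite /update /= tq tm size_rcons size_enum_ord; split.
    * exact: valid_product_counterexample.
    * exact: cq.
    (* The successor on [total s] leaves room for [k] pending tests here, and for the product query
       as well in the next bound. *)
    * by rewrite mulnS addnC leq_add2l.
    * by rewrite mulnS addSnnS addnC leq_add2l.
Qed.

Lemma transcript_ok O n : valid_oracle (prod_concept c) O ->
  let h := transcript product_strategy O n in
  consistent (product_state h).1 /\
  phase_ok (product_state h).1 (product_state h).2 h.
Proof.
move=> vO; elim: n => [|n /=].
  by split; [exact: consistent_init | split].
move: (transcript _ _ _) => h [cs ok].
case E: (product_strategy h) => [u|//]; rewrite product_state_rcons.
move: E cs ok; rewrite /product_strategy.
case: (product_state h) => s ph E cs ok.
exact: update_ok.
Qed.

(** A run may be cut before its last product query is paid for. Advancing the misclassified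
    coordinate still in the list gives a consistent state whose total covers it. *)
Lemma phase_ok_total s ph h : consistent s -> phase_ok s ph h ->
  exists s', [/\ consistent s', count_type q h <= total s'
    & count_type Membership h <= k * total s'].
Proof.
move=> cs; case: ph => [[x l]|[cq cm _]]; last by exists s.
case=> -[hx [i il mi]] cq cm _.
have [cs' lt] := advance_counterexample cs hx mi.
exists (advance (counterexample_at x i) s); split=> //.
  exact: leq_trans cq _.
by apply: leq_trans (leq_addr _ _) (leq_trans cm _); rewrite leq_mul2l lt orbT.
Qed.

Lemma product_action_ok s ph h u : consistent s -> phase_ok s ph h ->
  product_action (s, ph) = Ask u ->
  [set q; Membership] (type_of_query u) /\ query_in (prod_class C) u.
Proof.
move=> cs ok; rewrite /product_action /=; case: ph ok => [[x [|i l]]|] //=.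
  by move=> _ [<-]; split=> //; right.
move=> _; case: ifP => // _ [<-]; split.
  by left; exact: type_product_query.
rewrite /product_query; case: hq => -> /=; exists (hypotheses s); split=> // i;
  exact: hypotheses_in.
Qed.

Lemma product_action_output s ph h d : consistent s -> phase_ok s ph h ->
  product_action (s, ph) = Output d -> d = prod_concept c.
Proof.
move=> cs ok; rewrite /product_action /=; case: ph ok => [[x [|i l]]|] //=.
  by case=> -[_ []].
move=> _; case: forallP => // out [<-]; congr prod_concept.
by apply: functional_extensionality_dep => i; apply: hypothesis_output.
Qed.

(** * Termination and worst-case bounds *)

(** Without an output the history would grow forever. But the simulated histories form chains of
    runs, so their sizes and hence [total] stay bounded, and [phase_ok] then bounds the length of
    the history. *)
Lemma product_learns :
  learns_target (prod_class C) [set q; Membership] product_strategy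
    (prod_concept c).
Proof.
move=> O vO; split=> [n u E|].
  have [cs ok] := transcript_ok n vO.
  move: E cs ok; rewrite /product_strategy.
  case: (product_state _) => s ph E cs ok; exact: product_action_ok ok E.
suff [n [d E]] : exists n d,
    product_strategy (transcript product_strategy O n) = Output d.
  exists n; rewrite E; congr Output; have [cs ok] := transcript_ok n vO.
  move: E cs ok; rewrite /product_strategy.
  case: (product_state _) => s ph E cs ok; exact: product_action_output ok E.
apply: contrapT => noOut.
pose h n := transcript product_strategy O n.
have hS n : exists u a, h n.+1 = rcons (h n) (u, a).
  rewrite /h /=; case E: (product_strategy _) => [u|d].
    by exists u, (O (h n) u).
  by case: noOut; exists n, d.
have sz n : size (h n) = n.
  by elim: n => // n IH; have [u [a ->]] := hS n; rewrite size_rcons IH.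
have /boolp.choice[N HN] i : exists N, forall n,
    size ((product_state (h n)).1 i) <= N.
  apply: (chain_bounded (lA i)) => n.
    by have [/(_ i)[]] := transcript_ok n vO.
  have [u [a ->]] := hS n; rewrite product_state_rcons; exact: update_cat.
pose M := k.+1 * (\sum_i N i).+1.
have [cs] := transcript_ok M.+1 vO; rewrite -/(h _) => ok.
have le : total (product_state (h M.+1)).1 <= \sum_i N i.
  by apply: leq_sum => i _; exact: HN.
suff : size (h M.+1) <= M by rewrite sz ltnn.
case: (product_state (h M.+1)) ok le => s [[x l]|] /= [_ _]; rewrite /M.
  move=> _ H le; apply: leq_trans (leq_addr _ _) (leq_trans H _).
  by rewrite leq_mul2l ltnS le orbT.
by move=> H le; apply: leq_trans H _; rewrite leq_mul2l leqW ?orbT.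
Qed.

Import Order.TTheory GRing.Theory Num.Theory.

(** [total s'] is a sum of lengths of runs of the [A i], each at most the supremum [num_queries], be
    it finite or not. *)
Lemma product_num_queries (R : realType) (t : query_type) (m : nat) :
    (forall s ph h, consistent s -> phase_ok s ph h ->
      exists s', consistent s' /\ count_type t h <= m * total s') ->
  (num_queries R t product_strategy (prod_concept c) <=
    m%:R%R%:E * \sum_(i < k) num_queries R q (A i) (c i))%E.
Proof.
move=> bound; apply: ge_ereal_sup => _ [O [n [vO ->]]].
have [cs ok] := transcript_ok n vO.
have [s [{}cs le]] := bound _ _ _ cs ok.
apply: (@le_trans _ _ (m%:R%R%:E * \sum_(i < k) (size (s i))%:R%R%:E)%E).
  rewrite sumEFin -EFinM lee_fin -natr_sum -natrM ler_nat.
  exact: le.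
apply: lee_wpmul2l; first by rewrite lee_fin ler0n.
apply: lee_sum => i _; have [r _] := cs i.
exact: (size_run_le_num_queries (lA i) R erefl r).
Qed.

End ProductLearner.

Theorem proposition4 (R : realType) (k : nat) (X : 'I_k -> Type)
    (C : forall i : 'I_k, set (set (X i))) (q : query_type)
    (hq : q = Subset \/ q = Equivalence)
    (A : forall i : 'I_k, strategy (X i))
    (hA : forall i : 'I_k, learns (C i) [set q] (A i)) :
  exists B : (forall i : 'I_k, X i) -> strategy (forall i : 'I_k, X i),
    forall (c : forall i : 'I_k, set (X i)) (p : forall i : 'I_k, X i),
      (forall i : 'I_k, C i (c i)) -> prod_concept c p ->
      [/\ learns_target (prod_class C) [set q; Membership] (B p)
            (prod_concept c),
          num_queries R q (B p) (prod_concept c)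
            <= \sum_(i < k) num_queries R q (A i) (c i)
        & num_queries R Membership (B p) (prod_concept c)
            <= (k%:R)%:E * \sum_(i < k) num_queries R q (A i) (c i)].
Proof.
exists (product_strategy q A) => c p Cc cp; split.
- exact: product_learns.
- have := product_num_queries hq hA Cc cp R (t := q) (m := 1%N).
  rewrite mul1e; apply=> s ph h cs ok.
  have [s' [cs' le _]] := phase_ok_total hq hA Cc cp cs ok.
  by exists s'; rewrite mul1n.
- apply: (product_num_queries hq hA Cc cp) => s ph h cs ok.
  by have [s' [cs' _ le]] := phase_ok_total hq hA Cc cp cs ok; exists s'.
Qed.
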